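(* Fix an unshifted or a shifted skew shape $\mu/\lambda$, and let $P, Q$ be two standard skew tableaux (shifted standard skew tableaux in the shifted case) of shape $\mu/\lambda$. Let $A_{P,Q}$ denote the number of tabloids $T$ of shape $\mu/\lambda$ with $\operatorname{MJ}_P(T) = Q$, i.e. such that modified jeu de taquin in $T$ with respect to $P$ results in $Q$; likewise let $A_{Q,P}$ denote the number of tabloids $T$ of shape $\mu/\lambda$ with $\operatorname{MJ}_Q(T) = P$. Then $$A_{P,Q} = A_{Q,P}.$$
   Context: **Shapes.** A partition is a sequence of integers $\lambda = (\lambda_1,\dots,\lambda_r)$ with $\lambda_1 \ge \dots \ge \lambda_r \ge 0$ (trailing zeros are allowed, so that two partitions can be written with the same number $r$ of components). Cells are pairs $(i,j)$ = (row, column), with rows numbered from top to bottom and columns from left to right. The unshifted Ferrers diagram of $\lambda$ consists of the cells $(i,j)$ with $1\le i\le r$, $1 \le j \le \lambda_i$. If the nonzero components of $\lambda$ are distinct, the shifted Ferrers diagram of $\lambda$ consists of the cells $(i,j)$ with $1\le i\le r$, $i \le j \le i+\lambda_i-1$ (each row is indented by one cell to the right with respect to the previous row). If $\mu=(\mu_1,\dots,\mu_r)$ and $\lambda=(\lambda_1,\dots,\lambda_r)$ are partitions (in the shifted case, partitions with distinct nonzero components) with $\lambda_i \le \mu_i$ for all $1\le i \le r$, the unshifted (resp. shifted) skew Ferrers diagram of shape $\mu/\lambda$ is obtained by removing the cells of the unshifted (resp. shifted) Ferrers diagram of $\lambda$ from that of $\mu$. Its number of cells is $n = |\mu/\lambda|$.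 **Tabloids and tableaux.** A tabloid of (shifted) skew shape $\mu/\lambda$ is an arbitrary filling of the cells of the (shifted) skew Ferrers diagram of $\mu/\lambda$ with $1,2,\dots,n$, each used exactly once. A (shifted) standard skew tableau is a tabloid whose entries increase along rows (left to right) and down columns (top to bottom). **Forward jeu de taquin.** Let $T$ be a tabloid and $e$ an entry of $T$. Forward jeu de taquin in $T$ with $e$ is the following procedure, where cells outside the shape are regarded as having entry $\infty$. Consider the entry to the right of $e$ and the entry below $e$; if $e$ is greater than the minimum of these two, exchange $e$ with that minimum. Repeat with $e$ in its new position until $e$ is smaller than both its right neighbour and its neighbour below. **Modified jeu de taquin.** Let $T$ be a tabloid and $S$ a (shifted) standard skew tableau of the same shape. For $1 \le k\le n$ let $e_k$ be the entry of $T$ in the cell which has label (entry) $k$ in $S$. Starting with $T$, perform successively forward jeu de taquin with $e_n$, then (in the resulting tabloid) with $e_{n-1}$, and so on, down to $e_1$. The final result, which is a (shifted) standard skew tableau, is denoted $\operatorname{MJ}_S(T)$. *)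

(* Defs.v *)
From mathcomp Require Import all_boot all_fingroup.
Set Implicit Arguments.
Unset Strict Implicit.
Unset Printing Implicit Defensive.

(** Rows, columns and entries are all numbered from 0: the
    cell (i, j) here is the cell (i + 1, j + 1) of the usual convention, and the
    entry k : 'I_n stands for k + 1 in {1, ..., n}.  The boolean [sh] selects the
    shifted ([true]) or unshifted ([false]) setting throughout. *)

Definition is_partition (sh : bool) (la : seq nat) : bool :=
  sorted geq la && (sh ==> uniq [seq x <- la | 0 < x]).

(** [all2] also forces [la] and [mu] to have the same number of components. *)
Definition skew_shape (sh : bool) (mu la : seq nat) : bool :=
  [&& is_partition sh mu, is_partition sh la & all2 leq la mu].

Definition ferrers (sh : bool) (la : seq nat) : seq (nat * nat) :=
  [seq (i, (if sh then i else 0) + j) | i <- iota 0 (size la),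
                                        j <- iota 0 (nth 0 la i)].

Definition skew_cells (sh : bool) (mu la : seq nat) : seq (nat * nat) :=
  [seq c <- ferrers sh mu | c \notin ferrers sh la].

Definition cell (sh : bool) (mu la : seq nat) : finType :=
  seq_sub (skew_cells sh mu la).

Definition filling (sh : bool) (mu la : seq nat) : finType :=
  {ffun cell sh mu la -> 'I_#|cell sh mu la|}.

Section Tabloids.

Variables (sh : bool) (mu la : seq nat).
Local Notation cell := (cell sh mu la).
Local Notation filling := (filling sh mu la).
Implicit Types (c d : cell) (T U S : filling) (e k : 'I_#|cell|).

Definition row c : nat := (val c).1.
Definition col c : nat := (val c).2.

Definition tabloid T : bool := [forall k, #|[set c | T c == k]| == 1].

Definition standard S : bool :=
  [&& tabloid S,
      [forall c, forall d, (row c == row d) && (col c < col d) ==> (S c < S d)]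
    & [forall c, forall d, (col c == col d) && (row c < row d) ==> (S c < S d)]].

(** [None] when the neighbouring cell lies outside the shape, i.e. when its
    entry is regarded as infinite. *)
Definition right_nbr c : option cell := insub (row c, (col c).+1).
Definition below_nbr c : option cell := insub ((row c).+1, col c).

Definition min_nbr T c : option cell :=
  match right_nbr c, below_nbr c with
  | Some a, Some b => Some (if T a < T b then a else b)
  | Some a, None => Some a
  | None, ob => ob
  end.

Definition exchange T c d : filling := [ffun x => T (tperm c d x)].

(** Forward jeu de taquin with the entry in the cell [c], for at most [m]
    exchanges. *)
Fixpoint slide (m : nat) T c : filling :=
  if m is m'.+1 then
    if min_nbr T c is Some d then
      if T d < T c then slide m' (exchange T c d) d else T
    else T
  else T.

(** The bound is harmless: the moving entry never visits a cell twice, so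
    #|cell| exchanges always suffice (see [slide_bound] below). *)
Definition jdt T e : filling :=
  if [pick c | T c == e] is Some c then slide #|cell| T c else T.

(** [foldr] treats the largest label first.  The entry [T c] attached to the
    label [k] is read off the initial tabloid [T], not the current one [U]. *)
Definition MJ S T : filling :=
  foldr (fun k U => if [pick c | S c == k] is Some c then jdt U (T c) else U)
        T (enum 'I_#|cell|).

Lemma min_nbr_content T c d :
  min_nbr T c = Some d -> row d + col d = (row c + col c).+1.
Proof.
have R a : right_nbr c = Some a -> row a + col a = (row c + col c).+1.
  rewrite /right_nbr; case: insubP => // u _ uE [<-].
  by rewrite /row /col uE addnS.
have B a : below_nbr c = Some a -> row a + col a = (row c + col c).+1.
  rewrite /below_nbr; case: insubP => // u _ uE [<-].
  by rewrite /row /col uE addSn.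
rewrite /min_nbr; case Ea: (right_nbr c) => [a|]; case Eb: (below_nbr c) => [b|] //.
- by case: ifP => _ [<-]; [apply: R|apply: B].
- by move=> [<-]; apply: R.
- by move=> [<-]; apply: B.
Qed.

Lemma slide_bound m T c : #|cell| <= m -> slide m T c = slide #|cell| T c.
Proof.
pose A c := [set d | row c + col c < row d + col d].
suff H p q T' c' : #|A c'| <= p -> #|A c'| <= q -> slide p T' c' = slide q T' c'.
  by move=> le_m; apply: H; rewrite ?max_card // (leq_trans (max_card _)).
elim: p q T' c' => [|p IH] [|q] T' c' //= hp hq.
- case E: min_nbr => [d|] //; move: hp; rewrite leqn0 cards_eq0 => /eqP A0.
  by have := in_set0 d; rewrite -A0 inE (min_nbr_content E) ltnSn.
- case E: min_nbr => [d|] //; move: hq; rewrite leqn0 cards_eq0 => /eqP A0.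
  by have := in_set0 d; rewrite -A0 inE (min_nbr_content E) ltnSn.
case E: min_nbr => [d|] //; case: ifP => // _.
have lt : #|A d| < #|A c'|.
  apply: proper_card; apply/properP; split.
    by apply/subsetP=> x; rewrite !inE (min_nbr_content E); apply: ltnW.
  by exists d; rewrite !inE ?ltnn // (min_nbr_content E).
by apply: IH; rewrite -ltnS; apply: leq_trans lt _.
Qed.

End Tabloids.

(* Main.v *)
(** The map [T |-> P o T^-1 o Q] is a bijection between the two sets, because
    [MJ P T = Q] implies [MJ Q (P o T^-1 o Q) = P].  As in growth diagrams for the
    Robinson-Schensted correspondence, record for all [k] and [v] two cells: the
    position [h k v] of the entry labelled [k] when it has been compared with the
    entries smaller than [v], and the position [p k v] of the entry [v] once the
    labels at least [k] have been processed.  The rule that computes [h k v.+1] and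
    [p k v] from [h k v] and [p k.+1 v] reads the same in the opposite direction,
    that is, with [k] and [v] exchanged.  The boundary values are [P] and [Q], so
    transposing the array gives the run of the algorithm for [Q] and
    [P o T^-1 o Q].  Only the neighbour relation matters, not the geometry. *)
Require Import Defs.
From mathcomp Require Import all_boot all_fingroup.
Set Implicit Arguments.
Unset Strict Implicit.
Unset Printing Implicit Defensive.

Section ModifiedJeuDeTaquin.

Variables (sh : bool) (mu la : seq nat).
Local Notation cell := (cell sh mu la).
Local Notation filling := (filling sh mu la).
Implicit Types (a b c d z : cell) (P Q S T U V W : filling) (k m v : nat).

(** * Injective fillings and the neighbour relation *)

Lemma tabloid_inj T : tabloid T -> injective T.
Proof.
move=> /forallP tabT c d eqT; have /cards1P[a Ea] := tabT (T c).
have: c \in [set x | T x == T c] by rewrite inE.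
have: d \in [set x | T x == T c] by rewrite inE eqT.
by rewrite Ea !inE => /eqP-> /eqP->.
Qed.

Lemma filling_surj T (i : 'I_#|cell|) : injective T -> exists c, T c = i.
Proof.
move=> injT; have [|g _ gK] := inj_card_bij injT; first by rewrite card_ord.
by exists (g i).
Qed.

Lemma inj_tabloid T : injective T -> tabloid T.
Proof.
move=> injT; apply/forallP=> k; have [c <-] := filling_surj k injT.
by apply/cards1P; exists c; apply/setP=> d; rewrite !inE (inj_eq injT).
Qed.

Lemma pick_filling T c : injective T -> [pick d | T d == T c] = Some c.
Proof.
move=> injT; case: pickP => [d /eqP/injT->|/(_ c)] //.
by rewrite eqxx.
Qed.

Definition nbr c d := (right_nbr c == Some d) || (below_nbr c == Some d).

Definition increasing S := forall c d, nbr c d -> S c < S d.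

Lemma standard_increasing S : standard S -> increasing S.
Proof.
move=> /and3P[_ /forallP Srow /forallP Scol] c d /orP[] /eqP;
  rewrite /right_nbr /below_nbr; case: insubP => // u _ uE [<-].
- move: (Srow c) => /forallP/(_ u)/implyP; apply.
  by rewrite /row /col uE eqxx ltnSn.
- move: (Scol c) => /forallP/(_ u)/implyP; apply.
  by rewrite /row /col uE eqxx ltnSn.
Qed.

Variant min_nbr_spec W c : option cell -> Type :=
| MinNbrSome d of nbr c d & (forall b, nbr c b -> W d <= W b) :
    min_nbr_spec W c (Some d)
| MinNbrNone of (forall b, ~~ nbr c b) : min_nbr_spec W c None.

Lemma min_nbrP W c : min_nbr_spec W c (min_nbr W c).
Proof.
rewrite /min_nbr; case Er: (right_nbr c) => [a|]; case Eb: (below_nbr c) => [b|].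
- case: ltnP => ab; constructor; rewrite /nbr Er Eb ?eqxx ?orbT // => d.
    by case/orP=> /eqP[<-] //; apply: ltnW.
  by case/orP=> /eqP[<-].
- by constructor; rewrite /nbr Er Eb ?eqxx // => d; rewrite orbF => /eqP[<-].
- by constructor; rewrite /nbr Er Eb ?eqxx // => d /orP[]// /eqP[<-].
- by constructor=> b; rewrite /nbr Er Eb.
Qed.

(** * Exchanges and the path of a single slide *)

Lemma exchangeR W c d : exchange W c d d = W c.
Proof. by rewrite ffunE tpermR. Qed.

Lemma exchangeL W c d : exchange W c d c = W d.
Proof. by rewrite ffunE tpermL. Qed.

Lemma exchangeD W c d a : a != c -> a != d -> exchange W c d a = W a.
Proof. by move=> ac ad; rewrite ffunE tpermD // eq_sym. Qed.

Lemma exchange_inj W c d : injective W -> injective (exchange W c d).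
Proof. by move=> injW a b; rewrite !ffunE => /injW/perm_inj. Qed.

(** The position of the entry sliding in [W] from [c] once it has been compared
    with all entries smaller than [v]; meaningful only for [v <= W c]. *)
Fixpoint hole W c v : cell :=
  if v is u.+1 then
    odflt (hole W c u) [pick d | nbr (hole W c u) d && (W d == u :> nat)]
  else c.

Lemma hole_nbr W c d : injective W -> nbr (hole W c (W d)) d ->
  hole W c (W d).+1 = d.
Proof.
move=> injW cd /=; case: pickP => [a /andP[_ /eqP eqW]|/(_ d)].
  by apply: injW; apply: val_inj.
by rewrite cd eqxx.
Qed.

Lemma hole_not_nbr W c d : injective W -> ~~ nbr (hole W c (W d)) d ->
  hole W c (W d).+1 = hole W c (W d).
Proof.
move=> injW cd /=; case: pickP => [a /andP[ca /eqP eqW]|//].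
by rewrite -(injW a d (val_inj eqW)) eqW ca in cd.
Qed.

Lemma hole_stay W c v : (forall d, nbr c d -> v <= W d) -> hole W c v = c.
Proof.
elim: v => //= v IHv le_v; rewrite IHv => [|d /le_v/ltnW//].
by case: pickP => // d /andP[/le_v/[swap]/eqP->]; rewrite ltnn.
Qed.

Lemma hole_geq S W c v : increasing S -> S c <= S (hole W c v).
Proof.
move=> incS; elim: v => //= v IHv; case: pickP => //= d /andP[/incS lt_d _].
exact: leq_trans IHv (ltnW lt_d).
Qed.

Lemma hole_lt W c v : hole W c v = c \/ W (hole W c v) < v.
Proof.
elim: v => [|v IHv] /=; first by left.
case: pickP => [d /andP[_ /eqP <-]|_] /=; first by right.
by case: IHv => [->|/ltnW]; [left|right].
Qed.

(** The effect of a slide from [z], read off the initial filling [W]: entries above [W z] stay, and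
    a smaller entry moves exactly when the hole steps onto its cell, namely to where the hole was.
    The cells with [P]-label at least [k] form the processed region. *)
Record slide_spec P k W z W' : Prop := SlideSpec {
  slide_inj : injective W';
  slide_out a : P a < k -> W' a = W a;
  slide_incr a b : k <= P a -> nbr a b -> W' a < W' b;
  slide_hole : W' (hole W z (W z)) = W z;
  slide_gt a : W z < W a -> W' a = W a;
  slide_lt a : W a < W z ->
    W' (if nbr (hole W z (W a)) a then hole W z (W a) else a) = W a
}.

(** Induction on the number of exchanges. The region is increasing except from [z] to its
    neighbours, and entries just before [z] are below those just after it, so an exchange preserves
    this shape. Neighbours of [z] hold at least [v], so [W z <= v + m] allows enough exchanges. *)
Lemma slideP P k m v W z :
    increasing P -> injective W -> k <= P z ->
    (forall a b, k <= P a -> nbr a b -> a != z -> W a < W b) ->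
    (forall a b, k <= P a -> nbr a z -> nbr z b -> W a < W b) ->
    (forall b, nbr z b -> v <= W b) -> W z <= v + m ->
  slide_spec P k W z (slide m W z).
Proof.
move=> incP; have irr a b : nbr a b -> a != b.
  by move=> ab; apply: contraTneq (incP _ _ ab) => ->; rewrite ltnn.
elim: m v W z => [|m IHm] v W z injW Pz ordW ordz le_v fuel.
(* Common to base and step: when no neighbour is below [W z], the hole never moves and [W] itself
   meets the specification. *)
all: have stop : (forall b, nbr z b -> W z <= W b) -> slide_spec P k W z W.
1,3: move=> ltz; split=> //;
  [ move=> a b Pa ab; have [az|] := eqVneq a z; last exact: ordW;
    rewrite ltn_neqAle az ltz -?az // andbT val_eqE (inj_eq injW); exact: irr
  | by rewrite hole_stay
  | move=> a lta; rewrite ifN //; apply: contraTN (lta);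
    by rewrite hole_stay => [/ltz|d /ltz/(leq_trans (ltnW lta))//]; rewrite -leqNgt ].
- by apply: stop => b zb; rewrite addn0 in fuel; apply: leq_trans (le_v _ zb).
move=> /=; case: min_nbrP => [d zd mind|nonbr]; last first.
  by apply: stop => b; rewrite (negPf (nonbr b)).
case: ltnP => [ltd|le_d]; last first.
  by apply: stop => b /mind; apply: leq_trans.
have mind' b : nbr z b -> b != d -> W d < W b.
  by move=> zb bd; rewrite ltn_neqAle mind // andbT val_eqE (inj_eq injW) eq_sym.
have zNd := irr _ _ zd; have Pd := leq_trans Pz (ltnW (incP _ _ zd)).
have ndz b : nbr d b -> b != z.
  move=> db; apply: contraTneq (ltn_trans (incP _ _ zd) (incP _ _ db)) => ->.
  by rewrite ltnn.
set W' := exchange W z d.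
have W'z : W' z = W d by rewrite exchangeL.
have W'd : W' d = W z by rewrite exchangeR.
have W'D a : a != z -> a != d -> W' a = W a by exact: exchangeD.
have ltW' b : nbr d b -> W d < W' b.
  by move=> db; rewrite W'D ?ndz ?(ordW d) // eq_sym // irr.
have spec : slide_spec P k W' d (slide m W' d).
  (* Neighbours of [d] exceed [W d >= v], so the bound rises and pays for the exchange made. *)
  apply: (IHm (W d).+1) => //.
  - exact: exchange_inj.
  - move=> a b Pa ab ad; have [az|az] := eqVneq a z.
      rewrite az W'z; have [->|bd] := eqVneq b d; first by rewrite W'd.
      by rewrite W'D ?mind' -?az // eq_sym irr.
    rewrite W'D //; have [bz|bz] := eqVneq b z.
      by rewrite bz W'z ordz // -bz.
    have [bd|bd] := eqVneq b d; last by rewrite W'D ?ordW.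
    by rewrite bd W'd (ltn_trans _ ltd) // ordW // -bd.
  - move=> a b Pa ad db; have [->|az] := eqVneq a z; first by rewrite W'z ltW'.
    by rewrite (W'D a) ?(irr a d) // (ltn_trans (ordW _ _ Pa ad az)) ?ltW'.
  - by rewrite W'd addSnnS (leq_trans fuel) // leq_add2r; apply: le_v.
have stayz u : u <= W d -> hole W z u = z.
  by move=> le_u; apply: hole_stay => b /mind; apply: leq_trans.
have stayd u : u <= (W d).+1 -> hole W' d u = d.
  by move=> le_u; apply: hole_stay => b /ltW'; apply: leq_trans.
(* Both holes are at [d] for [u = (W d).+1]. Afterwards only values strictly between [W d] and [W z]
   are compared, and the exchange moved none of these. *)
have same u : W d < u -> u <= W z -> hole W' d u = hole W z u.
  elim: u => // u IHu; rewrite ltnS leq_eqVlt => /orP[/eqP <- _|lt_u le_u].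
    by rewrite stayd // hole_nbr // stayz.
  have ndu : W d != u :> nat by rewrite neq_ltn lt_u.
  have nzu : W z != u :> nat by rewrite neq_ltn le_u orbT.
  rewrite /= IHu ?(ltnW le_u) //; congr odflt; apply: eq_pick => a /=.
  have [->|az] := eqVneq a z; first by rewrite W'z (negPf ndu) (negPf nzu).
  have [->|ad] := eqVneq a d; first by rewrite W'd (negPf ndu) (negPf nzu).
  by rewrite W'D.
case: spec; rewrite -/W' W'd => injS outS incrS holeS gtS ltS; split=> //.
- move=> a Pa; rewrite outS ?W'D //.
    by apply: contraTneq Pa => ->; rewrite -leqNgt.
  by apply: contraTneq Pa => ->; rewrite -leqNgt.
- by rewrite -same.
- move=> a gta; have az : a != z by apply: contraTneq gta => ->; rewrite ltnn.
  have ad : a != d by apply: contraTneq gta => ->; rewrite -leqNgt ltnW.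
  by rewrite gtS W'D.
move=> a lta; have az : a != z by apply: contraTneq lta => ->; rewrite ltnn.
(* The entry [W d] ends in [z]; larger entries follow from [same]; for smaller ones neither hole has
   left its start. *)
have [->|ad] := eqVneq a d.
  have := ltS z; rewrite W'z stayz // zd stayd // => /(_ ltd).
  by rewrite ifN //; apply/negP => /ndz; rewrite eqxx.
have := ltS a; rewrite W'D // => /(_ lta).
have [gt_a|le_a] := ltnP (W d) (W a); first by rewrite same // ltnW.
rewrite stayd ?(leq_trans le_a) // stayz // !ifN //.
  by apply: contraL le_a => /mind'/(_ ad); rewrite ltnNge.
by apply: contraL le_a => /ltW'; rewrite W'D // ltnNge.
Qed.

(** * Partial runs of modified jeu de taquin *)

Definition MJ_step S T k U : filling :=
  if [pick c | S c == k :> nat] is Some c then jdt U (T c) else U.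

(** The filling after the entries labelled at least [k] have been processed. *)
Definition MJ_from S T k : filling :=
  foldr (MJ_step S T) T (drop k (iota 0 #|cell|)).

Lemma MJ_fromE S T : MJ S T = MJ_from S T 0.
Proof.
rewrite /MJ /MJ_from drop0 -val_enum_ord; elim: (enum _) => //= k s ->.
by rewrite /MJ_step; congr (if _ is Some c then _ else _); apply: eq_pick.
Qed.

Lemma MJ_fromS S T c : injective S ->
  MJ_from S T (S c) = jdt (MJ_from S T (S c).+1) (T c).
Proof.
move=> injS; rewrite /MJ_from (drop_nth 0) ?size_iota // nth_iota //= add0n.
by rewrite /MJ_step (pick_filling c injS).
Qed.

Record MJ_inv S T k : Prop := MJInv {
  MJ_inj : injective (MJ_from S T k);
  MJ_out c : S c < k -> MJ_from S T k c = T c;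
  MJ_incr c d : k <= S c -> nbr c d -> MJ_from S T k c < MJ_from S T k d
}.

(** Cell [c] still contains [T c] when its label comes up, so the slide starts there. Cells just
    before [c] have smaller labels, hence lie outside the processed region. *)
Lemma MJ_invS S T c : increasing S -> injective S -> MJ_inv S T (S c).+1 ->
  slide_spec S (S c) (MJ_from S T (S c).+1) c (MJ_from S T (S c)).
Proof.
move=> incS injS [inj out incr]; rewrite MJ_fromS // /jdt -(out c) //.
rewrite pick_filling //.
apply: (slideP (v := 0)) => //.
- move=> a b Sa ab ac; apply: incr => //.
  by rewrite ltn_neqAle Sa andbT eq_sym val_eqE (inj_eq injS).
- by move=> a b Sa /incS; rewrite ltnNge Sa.
- by rewrite ltnW.
Qed.

Lemma MJ_invP S T k : increasing S -> injective S -> injective T ->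
  k <= #|cell| -> MJ_inv S T k.
Proof.
move=> incS injS injT; move Dj: (#|cell| - k) => j.
elim: j k Dj => [|j IHj] k Dj le_k.
  have ->: k = #|cell| by apply/eqP; rewrite eqn_leq le_k -subn_eq0 Dj.
  split; rewrite /MJ_from drop_oversize ?size_iota //.
  by move=> c d; rewrite leqNgt ltn_ord.
have lt_k : k < #|cell| by rewrite -subn_gt0 Dj.
have [c /(congr1 val)/= Sc] := filling_surj (Ordinal lt_k) injS.
rewrite -Sc in Dj lt_k *.
have inv : MJ_inv S T (S c).+1 by apply: IHj; rewrite // subnS Dj.
have [inj out incr _ _ _] := MJ_invS incS injS inv; split=> // a Sa.
by rewrite out // (MJ_out inv) // ltnW.
Qed.

(** * Comparing the run with its transpose *)

Section Transpose.

Variables P Q T T' : filling.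
Hypotheses (incP : increasing P) (incQ : increasing Q).
Hypotheses (injP : injective P) (injQ : injective Q).
Hypotheses (injT : injective T) (injT' : injective T').
Hypothesis (MJ_T : MJ P T = Q).
Hypothesis (T'E : forall a b, T a = Q b -> T' b = P a).

Local Notation U := (MJ_from P T).
Local Notation V := (MJ_from Q T').

Let U_inv k : k <= #|cell| -> MJ_inv P T k.
Proof. exact: MJ_invP. Qed.

Let U_spec c : slide_spec P (P c) (U (P c).+1) c (U (P c)).
Proof. by apply: MJ_invS => //; apply: U_inv. Qed.

Let V_inv k : k <= #|cell| -> MJ_inv Q T' k.
Proof. exact: MJ_invP. Qed.

Let V_spec c : slide_spec Q (Q c) (V (Q c).+1) c (V (Q c)).
Proof. by apply: MJ_invS => //; apply: V_inv. Qed.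

Let U_start c : U (P c).+1 c = T c.
Proof. by have /U_inv := ltn_ord (P c); move/MJ_out->. Qed.

(** [slide_lt] computes [x] and the cell [y] of the entry [T a] after the slide
    from [z] and the cell of [T a] before it; here the latter two are recovered from
    [x] and [y], by the same rule. *)
Lemma square_rule a c x y z :
    P c < P a -> T a < T c -> U (P c) y = T a ->
    z = hole (U (P c).+1) c (T a) -> x = hole (U (P c).+1) c (T a).+1 ->
  if nbr y x then U (P c).+1 x = T a /\ z = y
  else U (P c).+1 y = T a /\ z = x.
Proof.
move=> ltP ltT Uy zE xE; have [injU outU incrU] := U_inv (ltn_ord (P c)).
have [injUc _ _ _ _ ltU] := U_spec c.
have [y' Uy'] := filling_surj (T a) injU.
have := ltU y'; rewrite U_start Uy' => /(_ ltT).
rewrite -[in RHS]Uy -zE => /injUc yE.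
have {}xE : x = if nbr z y' then y' else z.
  rewrite xE; case: ifPn; rewrite zE -Uy' => zy'; first exact: hole_nbr.
  exact: hole_not_nbr.
rewrite -yE xE; have [zy'|zy'] := boolP (nbr z y'); first by rewrite zy'.
(* Reversibility: [y'] cannot precede the hole [z]. If processed, it would precede [c] or a smaller
   entry; if not, it would be [a]. *)
rewrite ifN //; apply/negP => y'z; case: (ltnP (P c) (P y')) => [lt_y'|le_y'].
  have [zc|] := hole_lt (U (P c).+1) c (T a).
    by have := incP y'z; rewrite zE zc ltnNge ltnW.
  by rewrite -zE -Uy' ltnNge ltnW ?incrU.
have y'c : y' != c by apply: contraTneq ltT => y'c; rewrite -Uy' y'c U_start ltnn.
have y'a : y' = a by apply: injT; rewrite -Uy' outU ?ltnS.
by rewrite y'a leqNgt ltP in le_y'.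
Qed.

(** With [v = T a], this identifies [p k v] of the run [U] with the hole [h v k] of [V], by
    induction on [k]. The last hypothesis is the dual identity at [v.+1]. *)
Lemma hole_transpose a b k : T a = Q b -> k <= P a ->
    (forall c, T a < T c -> V (Q b).+1 (hole (U (P c).+1) c (T a).+1) = P c) ->
  U k (hole (V (Q b).+1) b k) = T a.
Proof.
move=> Tab + IH; elim: k => [|k IHk] lt_k; first by rewrite -MJ_fromE MJ_T.
have [c Pc] : exists c, P c = k :> nat.
  have [c Pc] := filling_surj (Ordinal (ltn_trans lt_k (ltn_ord _))) injP.
  by exists c; rewrite Pc.
have [d /esym Tcd] := filling_surj (T c) injQ; have T'd := T'E Tcd.
have [injV outV _] := V_inv (ltn_ord (Q b)).
rewrite -Pc in lt_k IHk *; set y := hole _ _ _ in IHk.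
have {}IHk := IHk (ltnW lt_k).
have [ltT|ltT|eqT] := ltngtP (T a) (T c); last first.
- by move: lt_k; rewrite (injT (val_inj eqT)) ltnn.
(* The slide with [T c] leaves the larger [T a] in place. In [V], the entry [P c] is still in [d],
   whose label is too small for the hole to step there. *)
- have [injUc _ _ _ gtU _] := U_spec c.
  have [y' Uy'] := filling_surj (T a) (MJ_inj (U_inv (ltn_ord (P c)))).
  have y'y : y' = y.
    by apply: injUc; rewrite gtU ?Uy' ?U_start // IHk.
  have Vd : V (Q b).+1 d = P c by rewrite outV // -Tcd -Tab ltnW.
  rewrite -Vd hole_not_nbr // Vd -/y; first by rewrite -y'y.
  apply/negP => /incQ; rewrite -Tcd ltnNge => /negP; apply.
  by rewrite (leq_trans (ltnW ltT)) // Tab hole_geq.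
have := square_rule lt_k ltT IHk (erefl _) (erefl _); have := IH _ ltT.
move: (hole (U (P c).+1) c (T a).+1) => x Vx; rewrite {IHk}/y.
rewrite -Vx; case: ifPn => yx [Ux _]; first by rewrite hole_nbr.
by rewrite hole_not_nbr.
Qed.

(** The dual identity: the hole [h k v] of [U], with [k = P c], is [p v k] of [V]. The induction on
    [v] runs downward because [hole_transpose] needs the identity at [v.+1]. *)
Lemma MJ_from_transpose v c : v <= T c ->
  V v (hole (U (P c).+1) c v) = P c.
Proof.
move=> le_v; have: v <= #|cell| by apply: leq_trans le_v (ltnW (ltn_ord _)).
move Dj: (#|cell| - v) => j; elim: j v Dj c le_v => [|j IHj] v Dj c le_v _.
  by move: (leq_ltn_trans le_v (ltn_ord (T c))); rewrite ltnNge -subn_eq0 Dj.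
have lt_v : v < #|cell| by rewrite -subn_gt0 Dj.
have [a Ta] := filling_surj (Ordinal lt_v) injT.
have [b Qb] := filling_surj (T a) injQ; have Tab := esym Qb.
move/(congr1 val): Ta => /= Ta.
have IH c' : T a < T c' -> V (Q b).+1 (hole (U (P c').+1) c' (T a).+1) = P c'.
  by rewrite -Tab Ta => ltT; apply: IHj; rewrite // subnS Dj.
have hole' k : k <= P a -> U k (hole (V (Q b).+1) b k) = T a.
  by move=> le_k; apply: hole_transpose.
have Vb : V (Q b).+1 b = P a.
  by have [_ -> // _] := V_inv (ltn_ord (Q b)); apply: T'E.
have [injV _ _ holeV gtV ltV] := V_spec b; rewrite Vb in holeV gtV ltV.
(* On the boundary [v = T c] both slides have ended, and injectivity of [U] identifies their final
   holes. *)
move: le_v; rewrite -Ta leq_eqVlt => /orP[/eqP/val_inj/injT <-|ltT].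
  have [injU _ _ holeU _ _] := U_spec a; rewrite U_start in holeU.
  rewrite {1}Tab -[RHS]holeV; congr (V _ _); apply: injU.
  by rewrite holeU hole'.
have Vx := IH _ ltT; rewrite {1}Tab.
have [ltP|ltP|eqP] := ltngtP (P a) (P c).
(* The slide with [P a] in [V] leaves the larger [P c] in place; the hole of [U] cannot step to [a],
   whose label is below that of [c]. *)
- rewrite -[RHS]Vx -gtV ?Vx //; congr (V _ _).
  have [injU outU _] := U_inv (ltn_ord (P c)).
  have Ua : U (P c).+1 a = T a by rewrite outU // ltnW.
  rewrite -Ua hole_not_nbr //; apply/negP => /incP; rewrite ltnNge => /negP; apply.
  by rewrite (leq_trans (ltnW ltP)) // hole_geq.
- have := square_rule ltP ltT (hole' _ (ltnW ltP)) (erefl _) (erefl _).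
  have := ltV (hole (U (P c).+1) c (T a).+1); rewrite Vx => /(_ ltP) VE.
  by case: ifP VE => yx VE [_ ->].
by move: ltT; rewrite (injP (val_inj eqP)) ltnn.
Qed.

Lemma MJ_transpose : MJ Q T' = P.
(* At value 0 the hole is still at its start [c]. *)
Proof. by apply/ffunP=> c; rewrite MJ_fromE (@MJ_from_transpose 0 c). Qed.

End Transpose.

(** * The injection between the two sets of tabloids *)

(** The map [P o T^-1 o Q]; [P b] is a dummy value. *)
Definition transpose P Q T : filling :=
  [ffun b => if [pick a | T a == Q b] is Some a then P a else P b].

Lemma transposeE P Q T a b : injective T -> T a = Q b -> transpose P Q T b = P a.
Proof. by move=> injT Tab; rewrite ffunE -Tab pick_filling. Qed.

Lemma transpose_inj P Q : injective P -> injective Q ->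
  {in @tabloid sh mu la &, injective (transpose P Q)}.
Proof.
move=> injP injQ T1 T2 /tabloid_inj inj1 /tabloid_inj inj2 eqT.
apply/ffunP=> a; have [b Qb] := filling_surj (T1 a) injQ.
have [a2 T2a2] := filling_surj (Q b) inj2.
have eqa : a = a2; last by rewrite -Qb -T2a2 -eqa.
by apply: injP; rewrite -(transposeE P inj1 (esym Qb)) eqT (transposeE P inj2 T2a2).
Qed.

Lemma tabloid_transpose P Q T : injective P -> injective Q -> injective T ->
  tabloid (transpose P Q T).
Proof.
move=> injP injQ injT; apply: inj_tabloid => b1 b2.
have [a1 T1] := filling_surj (Q b1) injT.
have [a2 T2] := filling_surj (Q b2) injT.
rewrite !(transposeE P injT T1, transposeE P injT T2) => /injP eqa.
by apply: injQ; rewrite -T1 -T2 eqa.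
Qed.

(** One inequality suffices, since exchanging [P] and [Q] gives the other. *)
Lemma leq_card_MJ P Q : standard P -> standard Q ->
  #|[set T : filling | tabloid T & MJ P T == Q]| <=
  #|[set T : filling | tabloid T & MJ Q T == P]|.
Proof.
move=> stP stQ; have incP := standard_increasing stP.
have incQ := standard_increasing stQ.
have injP : injective P by apply: tabloid_inj; case/and3P: stP.
have injQ : injective Q by apply: tabloid_inj; case/and3P: stQ.
rewrite -(card_in_imset (f := transpose P Q)) => [|T1 T2]; last first.
  by rewrite !inE => /andP[tab1 _] /andP[tab2 _]; apply: transpose_inj.
apply/subset_leq_card/subsetP => _ /imsetP[T + ->].
rewrite !inE => /andP[/tabloid_inj injT /eqP MJ_T].
have tabT' := tabloid_transpose injP injQ injT; rewrite tabT'.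
apply/eqP; apply: (MJ_transpose incP incQ injP injQ injT (tabloid_inj tabT') MJ_T).
by move=> a b; apply: transposeE.
Qed.

End ModifiedJeuDeTaquin.

Theorem corollary1 (sh : bool) (mu la : seq nat) (P Q : filling sh mu la)
    (hshape : skew_shape sh mu la) (hP : standard P) (hQ : standard Q) :
  #|[set T : filling sh mu la | tabloid T & MJ P T == Q]| =
  #|[set T : filling sh mu la | tabloid T & MJ Q T == P]|.
Proof. by apply/eqP; rewrite eqn_leq !leq_card_MJ. Qed.
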